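(* Let $\mathcal{C}$ be a pointed regular category. An object $Y$ of $\mathcal{C}$ is strongly unital if and only if it is unital and subtractive.
   Context: Regular categories are finitely complete. A pair of morphisms with common codomain $A$ is jointly strongly epimorphic if every monomorphism into $A$ through which both factor is an isomorphism. A point over $B$ is a pair $(f\colon A\to B,\ s\colon B\to A)$ with $fs=1_B$. Given $g\colon C\to B$, form the pullback $C\times_BA$ with projections $\pi_C,\pi_A$; the pullback of $(f,s)$ along $g$ is the point $(\pi_C,\langle 1_C,sg\rangle)$. The point $(f,s)$ is strong if for every $g\colon C\to B$ the pair $(\pi_A,s)$ is jointly strongly epimorphic; it is stably strong if its pullback along every morphism with codomain $B$ is strong. An object $Y$ is strongly unital if the point $(\pi_1\colon Y\times Y\to Y,\ \langle 1_Y,1_Y\rangle)$ is stably strong, and unital if the point $(\pi_1\colon Y\times Y\to Y,\ \langle 1_Y,0\rangle)$ is stably strong. A split right punctual span (from $X$ to $Y$) consists of morphisms $f\colon Z\to X$, $s\colon X\to Z$, $g\colon Z\to Y$, $t\colon Y\to Z$ with $fs=1_X$, $gt=1_Y$ and $ft=0$. An object $Y$ of a pointed regular category is subtractive if for every object $X$ and every split right punctual span $(f,s,g,t)$ from $X$ to $Y$, the morphism $f\ker(g)$ (the composite of the kernel $\ker(g)$ of $g$ with $f$) is a regular epimorphism. *)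

(* Defs.v *)
From Stdlib Require Import FinFun.

Set Implicit Arguments.
Unset Strict Implicit.

Declare Scope cat_scope.
Delimit Scope cat_scope with cat.

Record category : Type := Category {
  ob :> Type;
  hom : ob -> ob -> Type;
  idm : forall A : ob, hom A A;
  comp : forall A B D : ob, hom B D -> hom A B -> hom A D;
  comp_idl : forall (A B : ob) (f : hom A B), comp (idm B) f = f;
  comp_idr : forall (A B : ob) (f : hom A B), comp f (idm A) = f;
  comp_assoc : forall (A B D E : ob) (h : hom D E) (g : hom B D) (f : hom A B),
    comp h (comp g f) = comp (comp h g) f
}.

Arguments hom {_} _ _.
Arguments idm {_} _.
Arguments comp {_ _ _ _} _ _.

Notation "g ∘ f" := (comp g f) (at level 40, left associativity) : cat_scope.
Open Scope cat_scope.

Record functor (J C : category) : Type := Functor {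
  fob :> J -> C;
  fmap : forall i j : J, hom i j -> hom (fob i) (fob j);
  fmap_id : forall i : J, fmap (idm i) = idm (fob i);
  fmap_comp : forall (i j k : J) (v : hom j k) (u : hom i j),
    fmap (v ∘ u) = fmap v ∘ fmap u
}.

Definition is_cone (J C : category) (D : functor J C) (L : C)
    (p : forall j : J, hom L (D j)) : Prop :=
  forall (i j : J) (u : hom i j), fmap D u ∘ p i = p j.

Definition is_limit (J C : category) (D : functor J C) (L : C)
    (p : forall j : J, hom L (D j)) : Prop :=
  is_cone p /\
  forall (X : C) (q : forall j : J, hom X (D j)), is_cone q ->
    exists! h : hom X L, forall j : J, p j ∘ h = q j.

Definition finite_category (J : category) : Prop :=
  Finite J /\ forall i j : J, Finite (hom i j).

Definition finitely_complete (C : category) : Prop :=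
  forall J : category, finite_category J -> forall D : functor J C,
    exists (L : C) (p : forall j : J, hom L (D j)), is_limit p.

Definition is_product (C : category) (A B P : C)
    (p : hom P A) (q : hom P B) : Prop :=
  forall (X : C) (a : hom X A) (b : hom X B),
    exists! h : hom X P, p ∘ h = a /\ q ∘ h = b.

(* p and q are the projections of the pullback of f and g. *)
Definition is_pullback (C : category) (A B D P : C)
    (f : hom A B) (g : hom D B) (p : hom P A) (q : hom P D) : Prop :=
  f ∘ p = g ∘ q /\
  forall (X : C) (a : hom X A) (b : hom X D), f ∘ a = g ∘ b ->
    exists! h : hom X P, p ∘ h = a /\ q ∘ h = b.

Definition mono (C : category) (A B : C) (m : hom A B) : Prop :=
  forall (X : C) (u v : hom X A), m ∘ u = m ∘ v -> u = v.

Definition iso (C : category) (A B : C) (f : hom A B) : Prop :=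
  exists g : hom B A, g ∘ f = idm A /\ f ∘ g = idm B.

Definition is_coequalizer (C : category) (R A B : C)
    (u v : hom R A) (f : hom A B) : Prop :=
  f ∘ u = f ∘ v /\
  forall (X : C) (a : hom A X), a ∘ u = a ∘ v ->
    exists! h : hom B X, h ∘ f = a.

Definition regular_epi (C : category) (A B : C) (f : hom A B) : Prop :=
  exists (R : C) (u v : hom R A), is_coequalizer u v f.

Definition has_kernel_pair_coequalizers (C : category) : Prop :=
  forall (A B R : C) (f : hom A B) (u v : hom R A), is_pullback f f u v ->
    exists (Q : C) (e : hom A Q), is_coequalizer u v e.

Definition regular_epi_pullback_stable (C : category) : Prop :=
  forall (A B D P : C) (f : hom A B) (g : hom D B) (p : hom P A) (q : hom P D),
    is_pullback f g p q -> regular_epi f -> regular_epi q.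

Definition regular_category (C : category) : Prop :=
  finitely_complete C /\ has_kernel_pair_coequalizers C /\
  regular_epi_pullback_stable C.

Definition zero_object (C : category) (Z : C) : Prop :=
  (forall X : C, exists! f : hom X Z, True) /\
  (forall X : C, exists! f : hom Z X, True).

Definition pointed (C : category) : Prop := exists Z : C, zero_object Z.

(* In a pointed category, exactly one f : hom A B satisfies this predicate, so
   it renders the equation f = 0. *)
Definition is_zero (C : category) (A B : C) (f : hom A B) : Prop :=
  exists (Z : C) (u : hom A Z) (v : hom Z B), zero_object Z /\ f = v ∘ u.

Definition is_kernel (C : category) (A B K : C)
    (g : hom A B) (k : hom K A) : Prop :=
  is_zero (g ∘ k) /\
  forall (X : C) (a : hom X A), is_zero (g ∘ a) -> exists! h : hom X K, k ∘ h = a.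

Definition jointly_strongly_epi (C : category) (X Y A : C)
    (f : hom X A) (g : hom Y A) : Prop :=
  forall (M : C) (m : hom M A), mono m ->
    (exists f' : hom X M, m ∘ f' = f) -> (exists g' : hom Y M, m ∘ g' = g) ->
    iso m.

Record point (C : category) (B : C) : Type := Point {
  pt_ob : C;
  pt_map : hom pt_ob B;
  pt_sec : hom B pt_ob;
  pt_eq : pt_map ∘ pt_sec = idm B
}.

Arguments Point {C B pt_ob pt_map pt_sec} _.

(* Limits are determined only up to isomorphism, so the notions below quantify
   over all choices of pullbacks and products. *)

(* q is the pullback of the point p along g, with pA the projection to the
   domain of p; the last equation says that the section of q is <1, s g>. *)
Definition is_point_pullback (C : category) (B D : C) (p : point B)
    (g : hom D B) (q : point D) (pA : hom (pt_ob q) (pt_ob p)) : Prop :=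
  is_pullback g (pt_map p) (pt_map q) pA /\ pA ∘ pt_sec q = pt_sec p ∘ g.

Definition strong_point (C : category) (B : C) (p : point B) : Prop :=
  forall (D P : C) (g : hom D B) (pD : hom P D) (pA : hom P (pt_ob p)),
    is_pullback g (pt_map p) pD pA -> jointly_strongly_epi pA (pt_sec p).

Definition stably_strong_point (C : category) (B : C) (p : point B) : Prop :=
  forall (D : C) (g : hom D B) (q : point D) (pA : hom (pt_ob q) (pt_ob p)),
    is_point_pullback g pA -> strong_point q.

Definition strongly_unital (C : category) (Y : C) : Prop :=
  forall (P : C) (p1 p2 : hom P Y), is_product p1 p2 ->
  forall (d : hom Y P) (e1 : p1 ∘ d = idm Y), p2 ∘ d = idm Y ->
    stably_strong_point (Point e1).

Definition unital (C : category) (Y : C) : Prop :=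
  forall (P : C) (p1 p2 : hom P Y), is_product p1 p2 ->
  forall (i : hom Y P) (e1 : p1 ∘ i = idm Y), is_zero (p2 ∘ i) ->
    stably_strong_point (Point e1).

Definition split_right_punctual_span (C : category) (X Y Z : C)
    (f : hom Z X) (s : hom X Z) (g : hom Z Y) (t : hom Y Z) : Prop :=
  f ∘ s = idm X /\ g ∘ t = idm Y /\ is_zero (f ∘ t).

Definition subtractive (C : category) (Y : C) : Prop :=
  forall (X Z : C) (f : hom Z X) (s : hom X Z) (g : hom Z Y) (t : hom Y Z),
    split_right_punctual_span f s g t ->
    forall (K : C) (k : hom K Z), is_kernel g k -> regular_epi (f ∘ k).

(* Main.v *)
From Stdlib Require Import FinFun List.
Require Import Defs.
Import ListNotations.

(** Write <u,v> for the morphism into a product with components u and v.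
    Pulling back along 0 -> D shows that Y is strongly unital (unital) iff for
    every D the pair (<0,1_Y>, <1_D,g>) into D x Y is jointly strongly epimorphic
    for every g : D -> Y (for g = 0).  In particular strongly unital implies unital.

    If Y is strongly unital and (f,s,g,t) is a split right punctual span, then
    both <0,1> = <f,g> t and <1,gs> = <f,g> s factor through the image of <f,g>,
    so <f,g> is a regular epimorphism, and f ker(g) is its pullback along <1,0>.

    Conversely, a subobject m = <a,b> of D x Y containing s : <1,g> and t : <0,1>
    is a split right punctual span (a,s,b,t); as a ker(b) is a regular epimorphism
    and m ker(b) = <1,0> a ker(b), also <1,0> factors through m, and m is an
    isomorphism because Y is unital. *)

(** * Existence and uniqueness of maps into products and pullbacks *)

Section Limits.

Context {C : category}.

Lemma product_pair {A B P : C} {p : hom P A} {q : hom P B} :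
  is_product p q -> forall (X : C) (a : hom X A) (b : hom X B),
  exists h : hom X P, p ∘ h = a /\ q ∘ h = b.
Proof.
  intros HP X a b. destruct (HP X a b) as [h [Hh _]]. now exists h.
Qed.

Lemma product_ext {A B P : C} {p : hom P A} {q : hom P B} :
  is_product p q -> forall (X : C) (h h' : hom X P),
  p ∘ h = p ∘ h' -> q ∘ h = q ∘ h' -> h = h'.
Proof.
  intros HP X h h' e1 e2.
  destruct (HP X (p ∘ h') (q ∘ h')) as [k [_ Hk]].
  rewrite <- (Hk h (conj e1 e2)). now apply Hk.
Qed.

Lemma pullback_pair {A B D P : C} {f : hom A B} {g : hom D B}
    {p : hom P A} {q : hom P D} :
  is_pullback f g p q -> forall (X : C) (a : hom X A) (b : hom X D),
  f ∘ a = g ∘ b -> exists h : hom X P, p ∘ h = a /\ q ∘ h = b.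
Proof.
  intros [_ HP] X a b e. destruct (HP X a b e) as [h [Hh _]]. now exists h.
Qed.

Lemma pullback_ext {A B D P : C} {f : hom A B} {g : hom D B}
    {p : hom P A} {q : hom P D} :
  is_pullback f g p q -> forall (X : C) (h h' : hom X P),
  p ∘ h = p ∘ h' -> q ∘ h = q ∘ h' -> h = h'.
Proof.
  intros [e HP] X h h' e1 e2.
  destruct (HP X (p ∘ h') (q ∘ h')) as [k [_ Hk]].
  { now rewrite !comp_assoc, e. }
  rewrite <- (Hk h (conj e1 e2)). now apply Hk.
Qed.

End Limits.

(** * Pullbacks as limits of finite diagrams *)

Inductive cospan_ob : Type := Left | Right | Apex.

Definition cospan_hom (i j : cospan_ob) : Set :=
  match i, j with
  | Left, Left | Right, Right | _, Apex => unit
  | _, _ => Empty_set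
  end.

Definition cospan_id (i : cospan_ob) : cospan_hom i i :=
  match i with Left => tt | Right => tt | Apex => tt end.

Definition cospan_comp (i j k : cospan_ob) :
  cospan_hom j k -> cospan_hom i j -> cospan_hom i k.
Proof. destruct i, j, k; simpl; intros u v; (exact tt || contradiction). Defined.

Definition cospan : category.
Proof.
  refine (@Category cospan_ob cospan_hom cospan_id cospan_comp _ _ _).
  - intros [] [] []; reflexivity.
  - intros [] [] []; reflexivity.
  - intros [] [] [] [] [] [] []; reflexivity.
Defined.

Lemma finite_cospan : finite_category cospan.
Proof.
  split.
  - exists [Left; Right; Apex]. intros []; simpl; tauto.
  - intros [] []; first [now exists [tt]; intros []; left | now exists nil; intros []].
Qed.

Section CospanDiagram.

Context {C : category} {A B D : C} (f : hom A B) (g : hom D B).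

Definition cospan_fob (i : cospan) : C :=
  match i with Left => A | Right => D | Apex => B end.

Definition cospan_fmap (i j : cospan) :
  hom i j -> hom (cospan_fob i) (cospan_fob j).
Proof.
  destruct i, j; simpl; intros u;
    first [contradiction | exact (idm _) | exact f | exact g].
Defined.

Definition cospan_diagram : functor cospan C.
Proof.
  refine (@Functor cospan C cospan_fob cospan_fmap _ _).
  - intros []; reflexivity.
  - intros [] [] [] [] []; simpl; now rewrite ?comp_idl, ?comp_idr.
Defined.

(** In a cone the leg at [Apex] is forced by either of the other legs; here it is built from [a]. *)
Definition cospan_cone (X : C) (a : hom X A) (b : hom X D) (j : cospan) :
  hom X (cospan_diagram j) :=
  match j with Left => a | Right => b | Apex => f ∘ a end.

Lemma is_cone_cospan (X : C) (a : hom X A) (b : hom X D) :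
  f ∘ a = g ∘ b -> is_cone (cospan_cone X a b).
Proof.
  intros e [] [] []; simpl; now rewrite ?comp_idl.
Qed.

Lemma pullback_exists :
  finitely_complete C ->
  exists (P : C) (p : hom P A) (q : hom P D), is_pullback f g p q.
Proof.
  intros HC. destruct (HC cospan finite_cospan cospan_diagram) as (P & p & Hc & HL).
  pose proof (Hc Left Apex tt) as eL. pose proof (Hc Right Apex tt) as eR.
  simpl in eL, eR.
  exists P, (p Left), (p Right). split; [now rewrite eL, eR|].
  intros X a b e.
  destruct (HL X (cospan_cone X a b) (is_cone_cospan X a b e)) as (h & Hh & Hu).
  exists h. split; [split; [exact (Hh Left) | exact (Hh Right)]|].
  intros h' [ea eb]. apply Hu. intros []; simpl; trivial.
  now rewrite <- eL, <- ea, comp_assoc.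
Qed.

End CospanDiagram.

(** * Zero morphisms and binary products in pointed categories *)

Section ZeroMorphisms.

Context {C : category}.

(** The two factorizations may pass through different zero objects; the unique morphism [w] between
    these identifies them. *)
Lemma is_zero_unique {A B : C} (f g : hom A B) : is_zero f -> is_zero g -> f = g.
Proof.
  intros (Z & u & v & [_ HZi] & ->) (Z' & u' & v' & [HZ't HZ'i] & ->).
  destruct (HZ't Z) as [w _].
  destruct (HZ't A) as [x [_ Hx]]. destruct (HZi B) as [y [_ Hy]].
  assert (eu : w ∘ u = u') by now rewrite <- (Hx (w ∘ u) I), (Hx u' I).
  assert (ev : v' ∘ w = v) by now rewrite <- (Hy (v' ∘ w) I), (Hy v I).
  now rewrite <- eu, <- ev, comp_assoc.
Qed.

Lemma is_zero_compl {A B D : C} (h : hom B D) (f : hom A B) :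
  is_zero f -> is_zero (h ∘ f).
Proof.
  intros (Z & u & v & HZ & ->). exists Z, u, (h ∘ v).
  now rewrite comp_assoc.
Qed.

Lemma is_zero_compr {A B D : C} (f : hom B D) (h : hom A B) :
  is_zero f -> is_zero (f ∘ h).
Proof.
  intros (Z & u & v & HZ & ->). exists Z, (u ∘ h), v.
  now rewrite comp_assoc.
Qed.

Lemma zero_exists (hpt : pointed C) (A B : C) : exists f : hom A B, is_zero f.
Proof.
  destruct hpt as [Z HZ].
  destruct (proj1 HZ A) as [u _]. destruct (proj2 HZ B) as [v _].
  now exists (v ∘ u), Z, u, v.
Qed.

(** A pullback over the terminal object is a product. *)
Lemma product_exists (hfc : finitely_complete C) (hpt : pointed C) (A B : C) :
  exists (P : C) (p : hom P A) (q : hom P B), is_product p q.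
Proof.
  destruct hpt as [Z [HZ _]].
  destruct (HZ A) as [u _]. destruct (HZ B) as [v _].
  destruct (pullback_exists u v hfc) as (P & p & q & [_ HP]).
  exists P, p, q. intros X a b. apply HP.
  destruct (HZ X) as [w [_ Hw]]. now rewrite <- (Hw (u ∘ a) I), (Hw (v ∘ b) I).
Qed.

End ZeroMorphisms.

(** * Regular epimorphisms and images *)

Section RegularEpis.

Context {C : category}.

Lemma regular_epi_epi {A B : C} (e : hom A B) :
  regular_epi e -> forall (X : C) (x y : hom B X), x ∘ e = y ∘ e -> x = y.
Proof.
  intros (R & u & v & eq & He) X x y exy.
  destruct (He X (y ∘ e)) as [h [_ Hh]].
  { now rewrite <- !comp_assoc, eq. }
  rewrite <- (Hh x exy). now apply Hh.
Qed.

(** As [m] is mono, [k] identifies the pair that [e] coequalizes, hence factors through [e]. This is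
    the diagonal fill-in, of which only the lower triangle is recorded. *)
Lemma regular_epi_mono_lift {A B M D : C} (e : hom A B) (m : hom M D)
    (k : hom A M) (n : hom B D) :
  regular_epi e -> mono m -> m ∘ k = n ∘ e -> exists d : hom B M, m ∘ d = n.
Proof.
  intros Hre Hm emk. pose proof Hre as (R & u & v & eq & He).
  destruct (He M k) as [d [Hd _]].
  { apply Hm. now rewrite !comp_assoc, emk, <- !comp_assoc, eq. }
  exists d. apply (regular_epi_epi e Hre). now rewrite <- comp_assoc, Hd.
Qed.

(** The regular epi part is the coequalizer of the kernel pair of [f]; pullback stability of regular
    epis makes the comparison [m] mono. *)
Lemma image_factorization (hreg : regular_category C) {A B : C} (f : hom A B) :
  exists (Q : C) (e : hom A Q) (m : hom Q B),
    regular_epi e /\ mono m /\ m ∘ e = f.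
Proof.
  destruct hreg as (hfc & hkp & hst).
  destruct (pullback_exists f f hfc) as (R & u & v & HR).
  destruct (hkp _ _ _ _ _ _ HR) as (Q & e & He).
  assert (Hre : regular_epi e) by now exists R, u, v.
  destruct He as [eq He].
  destruct (He B f (proj1 HR)) as (m & Hm & _).
  exists Q, e, m. split; [exact Hre|]. split; [|exact Hm].
  (* The elements x, y of Q lift along e after a regular epi cover of T. *)
  intros T x y exy.
  destruct (pullback_exists e x hfc) as (T1 & a & z1 & H1).
  destruct (pullback_exists e (y ∘ z1) hfc) as (T2 & b & z2 & H2).
  apply (regular_epi_epi z1 (hst _ _ _ _ _ _ _ _ H1 Hre)).
  apply (regular_epi_epi z2 (hst _ _ _ _ _ _ _ _ H2 Hre)).
  destruct H1 as [e1 _], H2 as [e2 _].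
  (* The lifts of [x] and [y] have the same image under [f], so they form an element of the kernel
     pair, whose projections [e] equalizes. *)
  destruct (pullback_pair HR _ (a ∘ z2) b) as (r & Hu & Hv).
  { rewrite <- Hm, comp_assoc, <- !(comp_assoc m), e1, e2.
    now rewrite !comp_assoc, exy. }
  rewrite <- e1, <- e2, <- comp_assoc, <- Hu, <- Hv, !comp_assoc.
  now rewrite eq.
Qed.

End RegularEpis.

(** * Unitality and strong unitality in terms of sections of product projections *)

Section Unitality.

Context {C : category}.

(** The pullback of the point along [g] is the projection of D x Y with section <1, p2 d g>. To test
    its strength, pulling back along 0 -> D suffices: this yields the kernel [t] of [a], which
    factors through the projection of every other pullback. *)
Lemma stably_strong_product_point (hpt : pointed C) {Y P : C} {p1 p2 : hom P Y}
    (HP : is_product p1 p2) {d : hom Y P} (e1 : p1 ∘ d = idm Y) :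
  stably_strong_point (Point e1) <->
  forall (D W : C) (a : hom W D) (b : hom W Y), is_product a b ->
  forall (g : hom D Y) (s : hom D W) (t : hom Y W),
    a ∘ s = idm D -> b ∘ s = p2 ∘ d ∘ g -> is_zero (a ∘ t) -> b ∘ t = idm Y ->
    jointly_strongly_epi t s.
Proof.
  split.
  - intros HS D W a b HW g s t eas ebs eat ebt.
    (* [w] is g x 1, the projection showing [(a, s)] to be the pullback of the point along [g]. *)
    destruct (product_pair HP _ (g ∘ a) b) as (w & Hw1 & Hw2).
    destruct hpt as [Z HZ].
    destruct (proj2 HZ D) as [z _]. destruct (proj1 HZ Y) as [u _].
    apply (HS D g (Point eas) w) with (D := Z) (g := z) (pD := u); simpl.
    + split; simpl.
      * split; [now symmetry|].
        intros X x y exy.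
        destruct (product_pair HW _ x (p2 ∘ y)) as (h & Ha & Hb).
        exists h. split; [split; [exact Ha|]|].
        -- apply (product_ext HP).
           ++ now rewrite comp_assoc, Hw1, <- comp_assoc, Ha.
           ++ now rewrite comp_assoc, Hw2.
        -- intros h' [Ha' Hh']. apply (product_ext HW); [now rewrite Ha|].
           now rewrite Hb, <- Hh', comp_assoc, Hw2.
      * apply (product_ext HP); rewrite !comp_assoc.
        -- now rewrite Hw1, <- comp_assoc, eas, e1, comp_idl, comp_idr.
        -- now rewrite Hw2.
    + split.
      * apply is_zero_unique; [now exists Z, u, z | exact eat].
      * intros X x y exy. exists (b ∘ y). split; [split|].
        -- destruct (proj1 HZ X) as [q [_ Hq]].
           now rewrite <- (Hq x I), (Hq (u ∘ (b ∘ y)) I).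
        -- apply (product_ext HW); rewrite !comp_assoc.
           ++ rewrite <- exy, <- comp_assoc.
              apply is_zero_unique; [now apply is_zero_compr | now exists Z, x, z].
           ++ now rewrite ebt, comp_idl.
        -- intros h [_ <-]. now rewrite comp_assoc, ebt, comp_idl.
  - intros HJ D g [W a s eas] w [HW es] E Q h pE pW HQ. simpl in *.
    (* A pullback of a product projection is again a product projection. *)
    assert (HW' : is_product a (p2 ∘ w)).
    { intros X x y.
      destruct (product_pair HP _ (g ∘ x) y) as (k & Hk1 & Hk2).
      destruct (pullback_pair HW _ x k) as (l & Hl1 & Hl2); [now symmetry|].
      exists l. split; [split; [exact Hl1|]|].
      - now rewrite <- comp_assoc, Hl2.
      - intros l' [Ha Hb]. apply (pullback_ext HW); [now rewrite Ha|].
        apply (product_ext HP); rewrite !comp_assoc.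
        + rewrite <- (proj1 HW), <- !comp_assoc. now rewrite Hl1, Ha.
        + now rewrite Hb, <- comp_assoc, Hl2. }
    destruct (zero_exists hpt Y D) as [o Ho].
    destruct (zero_exists hpt Y E) as [o' Ho'].
    destruct (product_pair HW' _ o (idm Y)) as (t & Hta & Htb).
    (* [t] is <0,1>; as [a ∘ t] is zero it lifts to the pullback along [h], so any subobject through
       which [pW] factors also contains [t]. *)
    destruct (pullback_pair HQ _ o' t) as (r & _ & Hr).
    { rewrite Hta. apply is_zero_unique; [now apply is_zero_compl | exact Ho]. }
    intros M m Hm [m1 Hm1] Hm2.
    apply (HJ D W a (p2 ∘ w) HW' g s t); trivial.
    + now rewrite <- !comp_assoc, es.
    + now rewrite Hta.
    + exists (m1 ∘ r). now rewrite comp_assoc, Hm1.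
Qed.

(** For the diagonal, [p2 ∘ d ∘ g] is [g] itself, so [s] ranges over all sections of [a], with [g]
    recovered as [b ∘ s]. *)
Lemma strongly_unitalP (hfc : finitely_complete C) (hpt : pointed C) (Y : C) :
  strongly_unital Y <->
  forall (D W : C) (a : hom W D) (b : hom W Y), is_product a b ->
  forall (s : hom D W) (t : hom Y W),
    a ∘ s = idm D -> is_zero (a ∘ t) -> b ∘ t = idm Y ->
    jointly_strongly_epi t s.
Proof.
  split.
  - intros HY D W a b HW s t eas eat ebt.
    destruct (product_exists hfc hpt Y Y) as (P & p1 & p2 & HP).
    destruct (product_pair HP _ (idm Y) (idm Y)) as (d & e1 & e2).
    apply (proj1 (stably_strong_product_point hpt HP e1) (HY _ _ _ HP d e1 e2)
             D W a b HW (b ∘ s)); trivial.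
    now rewrite e2, comp_idl.
  - intros HJ P p1 p2 HP d e1 e2.
    apply (stably_strong_product_point hpt HP e1).
    intros D W a b HW g s t eas _. exact (HJ D W a b HW s t eas).
Qed.

(** With [i] = <1,0> the second component [p2 ∘ i ∘ g] of the section is zero for every [g]. *)
Lemma unitalP (hfc : finitely_complete C) (hpt : pointed C) (Y : C) :
  unital Y <->
  forall (D W : C) (a : hom W D) (b : hom W Y), is_product a b ->
  forall (s : hom D W) (t : hom Y W),
    a ∘ s = idm D -> is_zero (b ∘ s) -> is_zero (a ∘ t) -> b ∘ t = idm Y ->
    jointly_strongly_epi t s.
Proof.
  split.
  - intros HY D W a b HW s t eas ebs eat ebt.
    destruct (product_exists hfc hpt Y Y) as (P & p1 & p2 & HP).
    destruct (zero_exists hpt Y Y) as [o Ho].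
    destruct (product_pair HP _ (idm Y) o) as (i & e1 & e2).
    assert (Hi : is_zero (p2 ∘ i)) by now rewrite e2.
    apply (proj1 (stably_strong_product_point hpt HP e1) (HY _ _ _ HP i e1 Hi)
             D W a b HW (b ∘ s)); trivial.
    apply is_zero_unique; [exact ebs | now apply is_zero_compr].
  - intros HJ P p1 p2 HP i e1 Hi.
    apply (stably_strong_product_point hpt HP e1).
    intros D W a b HW g s t eas ebs. apply (HJ D W a b HW s t eas).
    rewrite ebs. now apply is_zero_compr.
Qed.

(** * Strong unitality compared with unitality and subtractivity *)

Lemma strongly_unital_unital (hfc : finitely_complete C) (hpt : pointed C) (Y : C) :
  strongly_unital Y -> unital Y.
Proof.
  intros HY. apply (unitalP hfc hpt). intros D W a b HW s t eas _.
  exact (proj1 (strongly_unitalP hfc hpt Y) HY D W a b HW s t eas).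
Qed.

Lemma strongly_unital_subtractive (hreg : regular_category C) (hpt : pointed C)
    (Y : C) :
  strongly_unital Y -> subtractive Y.
Proof.
  intros HY X Z f s g t (efs & egt & eft) K k [Hgk HK].
  destruct (product_exists (proj1 hreg) hpt X Y) as (W & a & b & HW).
  destruct (product_pair HW _ f g) as (fg & Ha & Hb).
  destruct (image_factorization hreg fg) as (Q & e & m & He & Hm & Hme).
  (* The image [m] contains both [fg ∘ s] and [fg ∘ t], so it has an inverse [n]. *)
  destruct (proj1 (strongly_unitalP (proj1 hreg) hpt Y) HY X W a b HW
              (fg ∘ s) (fg ∘ t)) with (M := Q) (m := m)
    as (n & Hnm & Hmn); rewrite ?comp_assoc, ?Ha, ?Hb; trivial.
  { exists (e ∘ t). now rewrite comp_assoc, Hme. }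
  { exists (e ∘ s). now rewrite comp_assoc, Hme. }
  destruct (zero_exists hpt X Y) as [o Ho].
  destruct (product_pair HW _ (idm X) o) as (i & Hai & Hbi).
  (* [f ∘ k] is the pullback of [e] along [n ∘ i], which is <1,0> carried into the image. *)
  apply (proj2 (proj2 hreg) _ _ _ _ e (n ∘ i) k (f ∘ k)); [|exact He].
  split.
  - apply Hm. rewrite !comp_assoc, Hmn, Hme, comp_idl.
    apply (product_ext HW); rewrite !comp_assoc.
    + now rewrite Ha, Hai, comp_idl.
    + rewrite Hb, Hbi, <- comp_assoc.
      apply is_zero_unique; [exact Hgk | now apply is_zero_compr].
  - intros T x y exy.
    assert (E : fg ∘ x = i ∘ y).
    { now rewrite <- Hme, <- comp_assoc, exy, !comp_assoc, Hmn, comp_idl. }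
    assert (Ef : f ∘ x = y).
    { now rewrite <- Ha, <- comp_assoc, E, comp_assoc, Hai, comp_idl. }
    (* The second component of [E] says that [g ∘ x] is zero, so [x] lifts to the kernel. *)
    destruct (HK T x) as (h & Hh & Hu).
    { rewrite <- Hb, <- comp_assoc, E, comp_assoc, Hbi. now apply is_zero_compr. }
    exists h. split; [split; [exact Hh|]|].
    + now rewrite <- comp_assoc, Hh.
    + intros h' [Hh' _]. now apply Hu.
Qed.

Lemma kernel_exists (hfc : finitely_complete C) (hpt : pointed C) {A B : C}
    (g : hom A B) :
  exists (K : C) (k : hom K A), is_kernel g k.
Proof.
  destruct hpt as [Z HZ]. destruct (proj2 HZ B) as [z [_ Hz]].
  destruct (pullback_exists g z hfc) as (K & k & q & HK).
  exists K, k. split.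
  - rewrite (proj1 HK). now exists Z, q, z.
  - intros X a Ha. destruct (proj1 HZ X) as [x [_ Hx]].
    destruct (pullback_pair HK _ a x) as (h & Hh & _).
    { apply is_zero_unique; [exact Ha | now exists Z, x, z]. }
    exists h. split; [exact Hh|].
    intros h' Hh'. apply (pullback_ext HK); [now rewrite Hh|].
    now rewrite <- (Hx (q ∘ h) I), (Hx (q ∘ h') I).
Qed.

Lemma unital_subtractive_strongly_unital (hfc : finitely_complete C)
    (hpt : pointed C) (Y : C) :
  unital Y -> subtractive Y -> strongly_unital Y.
Proof.
  intros HU HS. apply (strongly_unitalP hfc hpt).
  intros D W a b HW s t eas eat ebt M m Hm [t' <-] [s' <-].
  destruct (kernel_exists hfc hpt (b ∘ m)) as (K & k & HK).
  assert (Hre : regular_epi (a ∘ m ∘ k)).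
  { apply (HS D M (a ∘ m) s' (b ∘ m) t'); [|exact HK].
    split; [|split]; now rewrite <- comp_assoc. }
  destruct (zero_exists hpt D Y) as [o Ho].
  destruct (product_pair HW _ (idm D) o) as (i & Hai & Hbi).
  (* [m ∘ k] has components [a ∘ m ∘ k] and 0, so it equals [i ∘ (a ∘ m ∘ k)], and the fill-in puts
     [i] inside [m]. *)
  destruct (regular_epi_mono_lift (a ∘ m ∘ k) m k i Hre Hm) as (i' & Hi').
  { apply (product_ext HW); rewrite !comp_assoc.
    - now rewrite Hai, comp_idl.
    - rewrite Hbi. apply is_zero_unique; [exact (proj1 HK)|].
      now rewrite <- !comp_assoc; apply is_zero_compr. }
  apply (proj1 (unitalP hfc hpt Y) HU D W a b HW i (m ∘ t')); trivial.
  - now rewrite Hbi.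
  - now exists t'.
  - now exists i'.
Qed.

End Unitality.

Theorem proposition5p14 (C : category) (hreg : regular_category C)
    (hpt : pointed C) (Y : C) :
  strongly_unital Y <-> unital Y /\ subtractive Y.
Proof.
  split.
  - intros HY. split.
    + exact (strongly_unital_unital (proj1 hreg) hpt Y HY).
    + exact (strongly_unital_subtractive hreg hpt Y HY).
  - intros [HU HS].
    exact (unital_subtractive_strongly_unital (proj1 hreg) hpt Y HU HS).
Qed.
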